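(* Let $m\ge 0$ be an integer, $\lambda_0,\dots,\lambda_m\in\mathbb{R}$, $\alpha,\beta>0$, $k,r\in\mathbb{N}$, and consider the scalar time-space fractional partial differential equation $$\sum_{i=0}^{m}\lambda_i\frac{\partial^{\alpha+i}u(x,t)}{\partial t^{\alpha+i}}=\hat G[u(x,t)],\qquad \hat G[u]=G\left[x,u,\frac{\partial^{\beta}u}{\partial x^{\beta}},\dots,\frac{\partial^{\beta}}{\partial x^{\beta}}\left(\frac{\partial^{\beta}u}{\partial x^{\beta}}\right),\frac{\partial^{r\beta}u}{\partial x^{r\beta}},\frac{\partial^{\beta+k}u}{\partial x^{\beta+k}}\right],$$ where $G$ is a given sufficiently smooth function of its arguments (so $\hat G$ is a linear or nonlinear fractional differential operator in $x$). Let $\mathcal{W}_n=\left\{\sum_{j=1}^n a_j\varphi_j(x) : a_1,\dots,a_n\in\mathbb{R}\right\}$ be the $n$-dimensional linear space over $\mathbb{R}$ spanned by linearly independent functions $\varphi_1,\dots,\varphi_n$. Suppose $\mathcal{W}_n$ is invariant under $\hat G$, that is, $\hat G[w]\in\mathcal{W}_n$ for all $w\in\mathcal{W}_n$, and let $\Phi_1,\dots,\Phi_n:\mathbb{R}^n\to\mathbb{R}$ be the corresponding expansion coefficients, defined by $$\hat G\left[\sum_{j=1}^n a_j\varphi_j(x)\right]=\sum_{j=1}^n\Phi_j(a_1,\dots,a_n)\varphi_j(x)\qquad\text{for all } a_1,\dots,a_n\in\mathbb{R}.$$ Then the equation admits the exact solution $$u(x,t)=A_1(t)\varphi_1(x)+A_2(t)\varphi_2(x)+\dots+A_n(t)\varphi_n(x),$$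 where the coefficients $A_j(t)$ satisfy the system of fractional ordinary differential equations $$\sum_{i=0}^{m}\lambda_i\frac{d^{\alpha+i}A_j(t)}{dt^{\alpha+i}}=\Phi_j(A_1(t),A_2(t),\dots,A_n(t)),\qquad j=1,\dots,n;$$ that is, whenever $A_1,\dots,A_n$ satisfy this system, the function $u$ above is a solution of the equation.
   Context: The time and space fractional derivatives $\partial^{\alpha}/\partial t^{\alpha}$ and $\partial^{\beta}/\partial x^{\beta}$ are taken in the Riemann–Liouville sense or in the Caputo sense, with lower terminal $0$, in the variable indicated with the other variable held fixed. For a function $g$ of one variable $t>0$ and order $\alpha>0$ with $n-1<\alpha<n$, $n\in\mathbb{N}$: - Riemann–Liouville: $\dfrac{1}{\Gamma(n-\alpha)}\dfrac{d^n}{dt^n}\displaystyle\int_0^t\frac{g(s)}{(t-s)^{\alpha-n+1}}\,ds$; - Caputo: $\dfrac{1}{\Gamma(n-\alpha)}\displaystyle\int_0^t\frac{g^{(n)}(s)}{(t-s)^{\alpha-n+1}}\,ds$; and if $\alpha=n\in\mathbb{N}$ both are the ordinary derivative $g^{(n)}(t)$. The variables range over $x>0$, $t>0$. All fractional derivatives appearing (of the $\varphi_j$ in $x$ and of the $A_j$ in $t$) are understood to exist. When $\hat G$ is applied to a function $w(x)$ of $x$ alone, the same formula for $\hat G$ is used with $x$-derivatives of $w$; when applied to $u(x,t)$ it acts in $x$ for each fixed $t$. *)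

(* Defs.v *)
From HB Require Import structures.
From mathcomp Require Import all_boot all_order all_algebra.
From mathcomp Require Import all_classical all_reals all_analysis.

Set Implicit Arguments.
Unset Strict Implicit.
Unset Printing Implicit Defensive.

Import Order.TTheory GRing.Theory Num.Theory.
Import numFieldNormedType.Exports.

Local Open Scope classical_set_scope.
Local Open Scope ring_scope.

(* Functions of x > 0 or t > 0 are represented by total functions R -> R, whose
   values outside the open half-line are never used: every notion below depends
   only on the restriction to (0, +oo). *)

Section Fractional.
Context {R : realType}.
Implicit Types (a s t : R) (g : R -> R).

Definition Gamma a : R :=
  \int[lebesgue_measure]_(t in `]0%R, +oo[) (t `^ (a - 1) * expR (- t)).

Inductive frac_sense := RiemannLiouville | Caputo.

(* For a > 0 not an integer, the n with n - 1 < a < n; an integer a >= 0 gives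
   n = a. *)
Definition frac_ceil a : nat := `|Num.ceil a|%N.

Definition frac_integrand n a g t s : R := g s / (t - s) `^ (a - n%:R + 1).

Definition frac_integral n a g t : R :=
  \int[lebesgue_measure]_(s in `]0%R, t[) frac_integrand n a g t s.

Definition frac_derive (sense : frac_sense) a g : R -> R :=
  let n := frac_ceil a in
  if a \is a Num.nat then derive1n n g
  else match sense with
  | RiemannLiouville =>
      fun t => (Gamma (n%:R - a))^-1 * derive1n n (frac_integral n a g) t
  | Caputo =>
      fun t => (Gamma (n%:R - a))^-1 * frac_integral n a (derive1n n g) t
  end.

Definition n_derivable n g : Prop :=
  forall i, (i < n)%N -> forall t, 0 < t -> derivable (derive1n i g) t 1.

Definition frac_integrable n a g : Prop :=
  forall t, 0 < t -> lebesgue_measure.-integrable `]0%R, t[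
    (fun s => (frac_integrand n a g t s)%:E).

(* [frac_derive] is total; this says that its defining formula is meaningful
   at every point of (0, +oo). *)
Definition frac_derivable (sense : frac_sense) a g : Prop :=
  let n := frac_ceil a in
  if a \is a Num.nat then n_derivable n g
  else match sense with
  | RiemannLiouville => frac_integrable n a g /\ n_derivable n (frac_integral n a g)
  | Caputo => n_derivable n g /\ frac_integrable n a (derive1n n g)
  end.

(* f is C^N on the open set U: all its iterated directional derivatives of
   order at most N exist and are continuous on U. *)
Fixpoint smooth_on (V : normedModType R) (U : set V) (N : nat) (f : V -> R) : Prop :=
  (forall z, U z -> {for z, continuous f}) /\
  match N with
  | 0 => True
  | N'.+1 => forall v : V,
      (forall z, U z -> derivable f z v) /\ smooth_on U N' ('D_v f)
  end.

(* The arguments of G: x, then the values at x of the sequential derivatives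
   (D^b)^j w for 0 <= j <= q, of D^(r b) w and of D^(b + k) w. *)
Definition space_args (q : nat) : normedModType R :=
  (R * 'rV[R]_q.+1 * R * R)%type.

Definition positive_x (q : nat) : set (space_args q) :=
  [set z | 0 < z.1.1.1].

Definition Ghat (sense : frac_sense) (b : R) (q r k : nat)
    (G : space_args q -> R) (w : R -> R) : R -> R :=
  fun x => G (x, \row_(j < q.+1) iter j (frac_derive sense b) w x,
              frac_derive sense (r%:R * b) w x,
              frac_derive sense (b + k%:R) w x).

Definition space_derivable (sense : frac_sense) (b : R) (q r k : nat)
    (w : R -> R) : Prop :=
  [/\ forall j, (j < q)%N ->
        frac_derivable sense b (iter j (frac_derive sense b) w),
      frac_derivable sense (r%:R * b) w &
      frac_derivable sense (b + k%:R) w].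

Definition time_derivable (sense : frac_sense) (a : R) (m : nat)
    (g : R -> R) : Prop :=
  forall i, (i <= m)%N -> frac_derivable sense (a + i%:R) g.

Definition time_op (sense : frac_sense) (a : R) (m : nat)
    (lambda : 'I_m.+1 -> R) (g : R -> R) : R -> R :=
  fun t => \sum_(i < m.+1) lambda i * frac_derive sense (a + i%:R) g t.

Definition lincomb (n : nat) (phi : 'I_n -> R -> R) (c : 'rV[R]_n) : R -> R :=
  fun x => \sum_(j < n) c 0 j * phi j x.

Definition lin_indep (n : nat) (phi : 'I_n -> R -> R) : Prop :=
  forall c : 'rV[R]_n, (forall x, 0 < x -> lincomb phi c x = 0) -> c = 0.

Definition in_span (n : nat) (phi : 'I_n -> R -> R) (w : R -> R) : Prop :=
  exists c : 'rV[R]_n, forall x, 0 < x -> w x = lincomb phi c x.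

Definition invariant_span (n : nat) (phi : 'I_n -> R -> R)
    (F : (R -> R) -> R -> R) : Prop :=
  forall w, in_span phi w -> in_span phi (F w).

(* u x t is the unknown; the derivatives in the equation are required to exist. *)
Definition is_solution (tsense xsense : frac_sense) (a b : R) (m q r k : nat)
    (lambda : 'I_m.+1 -> R) (G : space_args q -> R) (u : R -> R -> R) : Prop :=
  [/\ forall x, 0 < x -> time_derivable tsense a m (u x),
      forall t, 0 < t -> space_derivable xsense b q r k (u^~ t) &
      forall x t, 0 < x -> 0 < t ->
        time_op tsense a lambda (u x) t = Ghat xsense b r k G (u^~ t) x].

Definition solves_system (tsense : frac_sense) (a : R) (m n : nat)
    (lambda : 'I_m.+1 -> R) (Phi : 'I_n -> 'rV[R]_n -> R)
    (A : 'I_n -> R -> R) : Prop :=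
  forall j t, 0 < t ->
    time_op tsense a lambda (A j) t = Phi j (\row_(l < n) A l t).

End Fractional.

Arguments positive_x {R} q.

(* Main.v *)
(* Since sums are finite and the relevant derivatives exist, the fractional
   operators act termwise: for u(x,t) = sum_j A_j(t) phi_j(x), the left side
   at (x, t) is sum_j (time operator of A_j)(t) phi_j(x), which the system turns
   into sum_j Phi_j(A(t)) phi_j(x); for fixed t, u(., t) is the element of W_n
   with coefficients A(t), so this is exactly the expansion of Ghat[u(., t)].
   Termwise differentiation holds only on the half-line (0, +oo), so iterating
   it relies on locality: each operator depends only on the restriction of its
   argument to the half-line. *)

Require Import Defs.
From mathcomp Require Import all_boot all_order all_algebra.
From mathcomp Require Import all_classical all_reals all_analysis.

Import Order.TTheory GRing.Theory Num.Theory.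
Import numFieldNormedType.Exports.

Local Open Scope ring_scope.

Set Implicit Arguments.
Unset Strict Implicit.
Unset Printing Implicit Defensive.

Section Linearity.
Local Open Scope classical_set_scope.
Local Open Scope ring_scope.
Context {R : realType}.
Implicit Types (a t : R) (f g : R -> R).

(** * Locality of the operators on the open half-line *)

(** A point [t > 0] is interior to the half-line, so agreement there is agreement near [t], which is
    all that a derivative at [t] sees. *)
Lemma near_eq_pos f g t : {in Num.pos, f =1 g} -> 0 < t ->
  \near t, f t = g t.
Proof.
move=> fg t0; near=> s; apply: fg; rewrite posrE.
by near: s; exact: lt_nbhsr.
Unshelve. all: end_near. Qed.

Lemma derivable_eq_pos f g t : {in Num.pos, f =1 g} -> 0 < t ->
  derivable f t 1 -> derivable g t 1.
Proof.
by move=> fg t0; apply: near_eq_derivable; exact: near_eq_pos.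
Qed.

Lemma derive1_eq_pos f g :
  {in Num.pos, f =1 g} -> {in Num.pos, derive1 f =1 derive1 g}.
Proof.
move=> fg t; rewrite posrE => t0; rewrite !derive1E.
by apply: near_eq_derive; exact: near_eq_pos.
Qed.

Lemma derive1n_eq_pos n f g :
  {in Num.pos, f =1 g} -> {in Num.pos, derive1n n f =1 derive1n n g}.
Proof. by move=> fg; elim: n => // n; exact: derive1_eq_pos. Qed.

Lemma n_derivable_eq_pos n f g : {in Num.pos, f =1 g} ->
  n_derivable n f -> n_derivable n g.
Proof.
move=> fg df i lt_in t t0; apply: derivable_eq_pos (df i lt_in t t0) => //.
exact: derive1n_eq_pos.
Qed.

Lemma frac_integrand_eq_pos n a f g t s : {in Num.pos, f =1 g} ->
  s \in `]0%R, t[ -> frac_integrand n a f t s = frac_integrand n a g t s.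
Proof.
by move=> fg; rewrite in_itv => /andP[s0 _]; rewrite /frac_integrand fg.
Qed.

(** The integrand is sampled only on []0, t[], which is empty for [t <= 0]; hence equality at every
    [t], not only at positive ones. *)
Lemma frac_integral_eq_pos n a f g : {in Num.pos, f =1 g} ->
  frac_integral n a f =1 frac_integral n a g.
Proof.
move=> fg t; apply: eq_Rintegral => s; rewrite inE => sI.
exact: frac_integrand_eq_pos.
Qed.

Lemma frac_integrable_eq_pos n a f g : {in Num.pos, f =1 g} ->
  frac_integrable n a f -> frac_integrable n a g.
Proof.
move=> fg If t t0; apply: eq_integrable (If t t0) => // s; rewrite inE => sI.
by congr EFin; exact: frac_integrand_eq_pos.
Qed.

Lemma frac_derive_eq_pos sense a f g : {in Num.pos, f =1 g} ->
  {in Num.pos, frac_derive sense a f =1 frac_derive sense a g}.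
Proof.
move=> fg t t0; rewrite /frac_derive; case: ifP => _.
  exact: derive1n_eq_pos.
case: sense; congr (_ * _).
  by apply: derive1n_eq_pos => // s _; exact: frac_integral_eq_pos.
exact/frac_integral_eq_pos/derive1n_eq_pos.
Qed.

Lemma frac_derivable_eq_pos sense a f g : {in Num.pos, f =1 g} ->
  frac_derivable sense a f -> frac_derivable sense a g.
Proof.
move=> fg; rewrite /frac_derivable; case: ifP => _.
  exact: n_derivable_eq_pos.
case: sense => -[].
  move=> If df; split; first exact: frac_integrable_eq_pos If.
  by apply: n_derivable_eq_pos df => s _; exact: frac_integral_eq_pos.
move=> df If; split; first exact: n_derivable_eq_pos df.
by apply: frac_integrable_eq_pos If; exact: derive1n_eq_pos.
Qed.

(** * Termwise action on finite linear combinations *)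

(** Exhibits the combination as a sum in the space of functions, the shape to which [derivable_sum]
    and [derive_sum] apply. *)
Lemma lincombE n (phi : 'I_n -> R -> R) (c : 'rV[R]_n) :
  lincomb phi c = \sum_(j < n) (c 0 j \*: phi j).
Proof. by apply/funext => x; rewrite fct_sumE. Qed.

Lemma derivable_lincomb n (phi : 'I_n -> R -> R) (c : 'rV[R]_n) t :
  (forall j, derivable (phi j) t 1) -> derivable (lincomb phi c) t 1.
Proof.
by move=> d; rewrite lincombE; apply: derivable_sum => j; exact: derivableZ.
Qed.

Lemma derive1_lincomb n (phi : 'I_n -> R -> R) (c : 'rV[R]_n) t :
  (forall j, derivable (phi j) t 1) ->
  derive1 (lincomb phi c) t = lincomb (fun j => derive1 (phi j)) c t.
Proof.
move=> d; rewrite lincombE derive1E derive_sum => [|j]; last exact: derivableZ.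
by apply: eq_bigr => j _; rewrite deriveZ// derive1E.
Qed.

Lemma derive1n_lincomb n (phi : 'I_n -> R -> R) (c : 'rV[R]_n) N :
  (forall j, n_derivable N (phi j)) ->
  {in Num.pos, derive1n N (lincomb phi c) =1
               lincomb (fun j => derive1n N (phi j)) c}.
Proof.
elim: N => [//|N IHN] d t t0.
have dN j : n_derivable N (phi j) by move=> i iN; apply: d; exact: ltnW.
(* The induction hypothesis is an identity on the half-line only; locality allows differentiating it
   at [t]. *)
rewrite derive1nS (derive1_eq_pos (IHN dN) t0) derive1_lincomb// => j.
exact: d.
Qed.

Lemma n_derivable_lincomb n (phi : 'I_n -> R -> R) (c : 'rV[R]_n) N :
  (forall j, n_derivable N (phi j)) ->
  n_derivable N (lincomb phi c).
Proof.
move=> d i iN t t0.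
have di j : n_derivable i (phi j) by move=> l li; apply: d; exact: ltn_trans iN.
apply: (@derivable_eq_pos (lincomb (fun j => derive1n i (phi j)) c)) => //.
  by move=> s s0; rewrite derive1n_lincomb.
by apply: derivable_lincomb => j; exact: d.
Qed.

Lemma frac_integrand_lincomb n (phi : 'I_n -> R -> R) (c : 'rV[R]_n) N a t s :
  frac_integrand N a (lincomb phi c) t s =
  \sum_(j < n) c 0 j * frac_integrand N a (phi j) t s.
Proof.
by rewrite /frac_integrand mulr_suml; apply: eq_bigr => j _; rewrite mulrA.
Qed.

Lemma frac_integrable_lincomb n (phi : 'I_n -> R -> R) (c : 'rV[R]_n) N a :
  (forall j, frac_integrable N a (phi j)) ->
  frac_integrable N a (lincomb phi c).
Proof.
move=> Iphi t t0.
(* [integrable_sum] concerns sums in the extended reals, so the summand is first put in that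
   form. *)
pose h j s := ((c 0 j)%:E * (frac_integrand N a (phi j) t s)%:E)%E.
have: lebesgue_measure.-integrable `]0%R, t[ (fun s => \sum_(j < n) h j s)%E.
  by apply: integrable_sum => // j _; apply: integrableZl => //; exact: Iphi.
apply: eq_integrable => // s _.
by rewrite frac_integrand_lincomb -sumEFin; apply: eq_bigr => j _.
Qed.

Lemma frac_integral_lincomb n (phi : 'I_n -> R -> R) (c : 'rV[R]_n) N a :
  (forall j, frac_integrable N a (phi j)) ->
  {in Num.pos, frac_integral N a (lincomb phi c) =1
               lincomb (fun j => frac_integral N a (phi j)) c}.
Proof.
move=> Iphi t t0.
have Ij j : lebesgue_measure.-integrable `]0%R, t[
    (fun s => (c 0 j * frac_integrand N a (phi j) t s)%:E).
  by apply: (integrableZl _ (c 0 j) (Iphi j t t0)).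
rewrite /frac_integral /Rintegral.
under eq_integral do rewrite frac_integrand_lincomb -sumEFin.
(* [fine] commutes with the sum because each integral is finite, by integrability. *)
rewrite integral_sum// -sum_fine => [|j _]; last exact: integrable_fin_num.
by apply: eq_bigr => j _; apply: RintegralZl => //; exact: Iphi.
Qed.

(** The two senses apply the integral and [derive1n] in opposite orders. In each, the inner operator
    is distributed first, and locality carries that identity through the outer one. *)
Lemma frac_derive_lincomb n (phi : 'I_n -> R -> R) (c : 'rV[R]_n) sense a :
  (forall j, frac_derivable sense a (phi j)) ->
  {in Num.pos, frac_derive sense a (lincomb phi c) =1
               lincomb (fun j => frac_derive sense a (phi j)) c}.
Proof.
rewrite /frac_derivable /frac_derive; case: ifP => _.
  exact: derive1n_lincomb.
case: sense => d t t0.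
  rewrite (derive1n_eq_pos _ (frac_integral_lincomb _ (fun j => (d j).1)) t0).
  rewrite derive1n_lincomb//; last by move=> j; case: (d j).
  by rewrite mulr_sumr; apply: eq_bigr => j _; rewrite mulrCA.
rewrite (frac_integral_eq_pos _ _ (derive1n_lincomb _ (fun j => (d j).1))).
rewrite frac_integral_lincomb//; last by move=> j; case: (d j).
by rewrite mulr_sumr; apply: eq_bigr => j _; rewrite mulrCA.
Qed.

Lemma frac_derivable_lincomb n (phi : 'I_n -> R -> R) (c : 'rV[R]_n) sense a :
  (forall j, frac_derivable sense a (phi j)) ->
  frac_derivable sense a (lincomb phi c).
Proof.
rewrite /frac_derivable; case: ifP => _.
  exact: n_derivable_lincomb.
case: sense => d; split.
- by apply: frac_integrable_lincomb => j; case: (d j).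
(* It suffices to treat the combination of the integrals, which inherits derivability from its
   terms. *)
- apply: (@n_derivable_eq_pos _
    (lincomb (fun j => frac_integral (frac_ceil a) a (phi j)) c)).
    by move=> t t0; rewrite frac_integral_lincomb// => j; case: (d j).
  by apply: n_derivable_lincomb => j; case: (d j).
- by apply: n_derivable_lincomb => j; case: (d j).
apply: (@frac_integrable_eq_pos _ _
  (lincomb (fun j => derive1n (frac_ceil a) (phi j)) c)).
  by move=> t t0; rewrite derive1n_lincomb// => j; case: (d j).
by apply: frac_integrable_lincomb => j; case: (d j).
Qed.

(** * Sequential derivatives and the two sides of the equation *)

Lemma iter_frac_derive_lincomb n (phi : 'I_n -> R -> R) (c : 'rV[R]_n)
    sense a q :
  (forall i j, (i < q)%N ->
     frac_derivable sense a (iter i (frac_derive sense a) (phi j))) ->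
  {in Num.pos, iter q (frac_derive sense a) (lincomb phi c) =1
               lincomb (fun j => iter q (frac_derive sense a) (phi j)) c}.
Proof.
elim: q => [//|q IHq] d t t0.
rewrite iterS (frac_derive_eq_pos _ _ (IHq _) t0) => [|i j iq].
  by rewrite frac_derive_lincomb// => j; exact: d.
by apply: d; exact: ltnW.
Qed.

Lemma space_derivable_lincomb n (phi : 'I_n -> R -> R) (c : 'rV[R]_n)
    sense b q r k :
  (forall j, space_derivable sense b q r k (phi j)) ->
  space_derivable sense b q r k (lincomb phi c).
Proof.
move=> d; split=> [i iq||].
- apply: (@frac_derivable_eq_pos _ _
    (lincomb (fun j => iter i (frac_derive sense b) (phi j)) c)).
    move=> x x0; rewrite iter_frac_derive_lincomb// => l j li.
    by case: (d j) => + _ _; apply; exact: ltn_trans iq.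
  by apply: frac_derivable_lincomb => j; case: (d j) => + _ _; exact.
- by apply: frac_derivable_lincomb => j; case: (d j).
- by apply: frac_derivable_lincomb => j; case: (d j).
Qed.

Lemma time_derivable_lincomb n (phi : 'I_n -> R -> R) (c : 'rV[R]_n) sense a m :
  (forall j, time_derivable sense a m (phi j)) ->
  time_derivable sense a m (lincomb phi c).
Proof.
by move=> d i im; apply: frac_derivable_lincomb => j; exact: d.
Qed.

Lemma time_op_lincomb n (phi : 'I_n -> R -> R) (c : 'rV[R]_n) sense a m
    (lambda : 'I_m.+1 -> R) :
  (forall j, time_derivable sense a m (phi j)) ->
  {in Num.pos, time_op sense a lambda (lincomb phi c) =1
               lincomb (fun j => time_op sense a lambda (phi j)) c}.
Proof.
move=> d t t0; rewrite /time_op /lincomb.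
(* Once the sums over the functions [j] and the orders [i] are exchanged, each order needs a single
   use of [frac_derive_lincomb]. *)
under [RHS]eq_bigr do rewrite mulr_sumr.
rewrite exchange_big; apply: eq_bigr => i _ /=.
rewrite frac_derive_lincomb// => [|j]; last by apply: d; rewrite -ltnS.
by rewrite mulr_sumr; apply: eq_bigr => j _; rewrite mulrCA.
Qed.

End Linearity.

Theorem theorem2p5 (R : realType) (tsense xsense : frac_sense)
  (m : nat) (lambda : 'I_m.+1 -> R) (alpha beta : R) (q r k N n : nat)
  (G : space_args q -> R) (phi : 'I_n -> R -> R)
  (Phi : 'I_n -> 'rV[R]_n -> R) (A : 'I_n -> R -> R)
  (alpha_gt0 : 0 < alpha) (beta_gt0 : 0 < beta)
  (G_smooth : smooth_on (positive_x q) N G)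
  (phi_indep : lin_indep phi)
  (phi_derivable : forall j, space_derivable xsense beta q r k (phi j))
  (W_invariant : invariant_span phi (Ghat xsense beta r k G))
  (Phi_def : forall (a : 'rV[R]_n) (x : R), 0 < x ->
     Ghat xsense beta r k G (lincomb phi a) x =
     \sum_(j < n) Phi j a * phi j x)
  (A_derivable : forall j, time_derivable tsense alpha m (A j))
  (A_system : solves_system tsense alpha lambda Phi A) :
  is_solution tsense xsense alpha beta r k lambda G
    (fun x t => \sum_(j < n) A j t * phi j x).
Proof.
set u := fun x t => _.
(* The same sum is read in two ways: for fixed [x] the [A j] are the functions and the values
   [phi j x] the constants; for fixed [t] the roles are exchanged. *)
have uxE x : u x = lincomb A (\row_j phi j x).
  by apply/funext => t; apply: eq_bigr => j _; rewrite mxE mulrC.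
have utE t : u^~ t = lincomb phi (\row_j A j t).
  by apply/funext => x; apply: eq_bigr => j _; rewrite mxE.
split=> [x _|t _|x t x0 t0].
- by rewrite uxE; exact: time_derivable_lincomb.
- by rewrite utE; exact: space_derivable_lincomb.
(* [Phi_def] is used at the coefficient row of the values [A j t], the very row at which [A_system]
   evaluates [Phi j]. *)
rewrite uxE utE Phi_def// time_op_lincomb//.
by apply: eq_bigr => j _; rewrite mxE A_system// mulrC.
Qed.
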